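(* Let $G$ be an arbitrary loop-free CHR Grammar whose grammar symbols have no attributes and whose rules use no left or right context parts and no extra-grammatical constraints. Without loss of generality the rules are taken to have one or two grammar symbols in the head, so that the compiled rules are of the forms $$\text{(type 1)}\quad A(i,j)\Rightarrow B(i,j),\qquad\qquad \text{(type 2)}\quad A(i,j),\,B(j,k)\Rightarrow C(i,k),$$ each being either a propagation rule or a simplification rule. Then the total time complexity of parsing an input string of length $n$ with $G$, i.e., the time for reaching a final state from the initial state given by the string, is of order $\mathcal{O}(n^3)$.
   Context: A CHR Grammar has a finite vocabulary of grammar symbols (terminals and nonterminals) and a finite set of grammar rules. A rule without context parts and extra-grammatical constraints has a nonempty sequence of grammar symbols as its head and exactly one nonterminal as its body. A single production is a rule with exactly one grammar symbol in its head (and one in its body). The grammar is loop-free if there is no chain of single productions leading from $g_1$ to $g_2$, from $g_2$ to $g_3$, ..., from $g_{m-1}$ to $g_m$ with $g_1=g_m$. The grammar is executed bottom-up. A state is a set of indexed grammar symbols $A(i,j)$, where $0\le i<j\le n$ are word boundaries. The initial state for a string $a_1\cdots a_n$ consists of the terminals $a_m$ indexed by $(m-1,m)$ for $1\le m\le n$ (''without attributes'' refers to nonterminals; each token counts as a terminal symbol of its own). Rules are compiled by adding word-boundary arguments, so that consecutive symbols in the head share a boundary and the body spans the same interval as the head. A rule can be applied to a state that contains an instance of its head. A propagation rule then adds the corresponding instance of the body; a simplification rule in addition removes the head instance. A given propagation rule is not applied more than once to the same indexed symbols. A state is final if no rule can be applied to it. Time is the running time of bottom-up evaluation of logic programs with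 deletion, as given by the known meta-complexity theorem for such programs (Ganzinger and McAllester): a final state is reached in time $\mathcal{O}(n+p)$, where $n$ is the number of constraints in the initial state (here the length of the string) and $p$ is the number of prefix firings that have appeared in some state of the derivation. The prefix firings are: for each type 1 rule, the occurrences of $A(i,j)$; for each type 2 rule, the occurrences of $A(i,j)$ and the occurrences in one and the same state of the entire head $A(i,j),B(j,k)$. The grammar is fixed, so constants hidden in $\mathcal{O}$ may depend on $G$ but not on the string. *)

(* Defs.v *)
From mathcomp Require Import all_boot.

Set Implicit Arguments.
Unset Strict Implicit.
Unset Printing Implicit Defensive.

(* CHR grammars without attributes, context parts or extra-grammatical        *)
(* constraints, with one or two grammar symbols in each rule head.            *)

Inductive rule_kind := Propagation | Simplification.

Inductive rule_head (S : Type) := One of S | Two of S & S.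

(* [rule G] is the finite type of rule names, so the rule set is finite.      *)
Record chr_grammar := ChrGrammar {
  terminal : finType;
  nonterminal : finType;
  rule : finType;
  kind : rule -> rule_kind;
  head : rule -> rule_head (terminal + nonterminal);
  body : rule -> nonterminal }.

Definition symbol (G : chr_grammar) : finType :=
  (terminal G + nonterminal G)%type.

Definition body_symbol (G : chr_grammar) (r : rule G) : symbol G :=
  inr (body r).

Definition single_production (G : chr_grammar) : rel (symbol G) := fun g h =>
  [exists r : rule G,
     if head r is One A then (A == g) && (body_symbol r == h) else false].

Definition loop_free (G : chr_grammar) : Prop :=
  forall (g : symbol G) (s : seq (symbol G)),
    s != [::] -> path (@single_production G) g s -> last g s != g.

Section Evaluation.

Variables (G : chr_grammar) (n : nat).

Definition boundary : finType := 'I_n.+1.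

(* (A, i, j) stands for A(i,j).  The condition i < j is not built into the    *)
(* type: it holds in the initial state and rule applications preserve it.     *)
Definition item : finType := (symbol G * boundary * boundary)%type.

Definition state : finType := {set item}.

(* [instance r H b]: H is the set of indexed symbols in the head, and b the   *)
(* body, of one ground instance of the compiled rule r.                       *)
Definition instance (r : rule G) (H : {set item}) (b : item) : bool :=
  match head r with
  | One A =>
      [exists i : boundary, exists j : boundary,
         (H == [set (A, i, j)]) && (b == (body_symbol r, i, j))]
  | Two A B =>
      [exists i : boundary, exists j : boundary, exists k : boundary,
         (H == [set (A, i, j); (B, j, k)]) && (b == (body_symbol r, i, k))]
  end.

(* A state together with the record of the propagation rules already applied  *)
(* and the indexed symbols they were applied to.                              *)
Definition config : finType := (state * {set rule G * {set item}})%type.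

Definition step : rel config := fun c c' =>
  [exists r : rule G, exists H : {set item}, exists b : item,
     [&& instance r H b, H \subset c.1 &
         match kind r with
         | Propagation =>
             ((r, H) \notin c.2) && (c' == (b |: c.1, (r, H) |: c.2))
         | Simplification => c' == (b |: (c.1 :\: H), c.2)
         end]].

Definition final (c : config) : bool := [forall c' : config, ~~ step c c'].

(* Word positions m : 'I_n count from 0, so that the token at position m lies *)
(* between the boundaries m and m + 1.                                        *)
Definition initial (w : n.-tuple (terminal G)) : config :=
  ([set ((inl (tnth w m), inord m, inord m.+1) : item) | m : 'I_n], set0).

Definition complete_derivation (w : n.-tuple (terminal G)) (cs : seq config) :
  bool := path step (initial w) cs && final (last (initial w) cs).

(* Whichever applicable rule is chosen at each step, a final state is         *)
(* reached.                                                                   *)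
Definition terminates (w : n.-tuple (terminal G)) : Prop :=
  forall f : nat -> config,
    f 0 = initial w ->
    (forall t, ~~ final (f t) -> step (f t) (f t.+1)) ->
    exists t, final (f t).

(* The ground instances of the nonempty prefixes of the head of r.  When      *)
(* i < j < k, the set {A(i,j), B(j,k)} determines both indexed symbols and    *)
(* differs from every singleton, so no two prefix firings get identified.     *)
Definition head_prefix (r : rule G) (P : {set item}) : bool :=
  match head r with
  | One A => [exists i : boundary, exists j : boundary, P == [set (A, i, j)]]
  | Two A B =>
      [exists i : boundary, exists j : boundary, P == [set (A, i, j)]]
      || [exists i : boundary, exists j : boundary, exists k : boundary,
            P == [set (A, i, j); (B, j, k)]]
  end.

Definition prefix_firings (cs : seq config) : {set rule G * {set item}} :=
  [set f : rule G * {set item} |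
     head_prefix f.1 f.2 && has (fun c : config => f.2 \subset c.1) cs].

End Evaluation.

(* The bound O(n + p) of the Ganzinger-McAllester meta-complexity theorem on  *)
(* the time spent by the evaluator along a derivation that reaches a final    *)
(* state, for the fixed grammar G.                                            *)
Definition meta_complexity (G : chr_grammar)
    (time : forall n : nat, n.-tuple (terminal G) -> seq (config G n) -> nat) :
    Prop :=
  exists c : nat, forall (n : nat) (w : n.-tuple (terminal G))
                         (cs : seq (config G n)),
    0 < n -> complete_derivation w cs ->
    time n w cs <= c * (n + #|prefix_firings (initial w :: cs)|).

(* Main.v *)
(* Termination: weigh an indexed symbol by |symbols| plus the number of symbols reachable from it
   by single productions.  By loop-freeness a type 1 simplification lowers the total weight of the
   state, and so does a type 2 simplification, because two weights together always exceed a third.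
   A propagation may raise the total weight, but it happens at most once for each rule and head
   instance, which gives a lexicographic measure.  The time bound follows because a prefix firing
   is determined by its rule, three boundaries and the length of the prefix. *)
Require Import Defs.
From mathcomp Require Import all_boot.

Set Implicit Arguments.
Unset Strict Implicit.
Unset Printing Implicit Defensive.

(** If [b] already lies in [S :\: H], adding it changes nothing, and the sum still drops because the
    hypothesis makes the sum over [H] positive. *)
Lemma ltn_sum_replace (T : finType) (F : T -> nat) (S H : {set T}) (b : T) :
  H \subset S -> F b < \sum_(x in H) F x ->
  \sum_(x in b |: (S :\: H)) F x < \sum_(x in S) F x.
Proof.
move=> /setIidPr HS ltb; rewrite [X in _ < X](big_setID H) /= HS.
case: (boolP (b \in S :\: H)) => bS; last by rewrite big_setU1 //= ltn_add2r.
by rewrite (setUidPr _) ?sub1set // -[X in X < _]add0n ltn_add2r (leq_ltn_trans _ ltb).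
Qed.

Section Weight.

Variable G : chr_grammar.

Definition height (g : symbol G) : nat := #|connect (@single_production G) g|.

(** Everything reachable from [h] is reachable from [g], but [g] itself is not reachable from [h]: a
    path back would close a cycle of single productions. *)
Lemma height_single_production (g h : symbol G) :
  loop_free G -> single_production g h -> height h < height g.
Proof.
move=> lf gh; apply/proper_card/properP; split.
  by apply/subsetP=> x; apply: connect_trans; apply: connect1.
exists g; first exact: connect0.
apply/negP=> /connectP[s hs gs].
by have := lf g (h :: s) isT; rewrite /= gh hs -gs eqxx => /(_ isT).
Qed.

Definition weight (g : symbol G) : nat := #|symbol G| + height g.

Lemma weight_max (g : symbol G) : weight g <= #|symbol G| + #|symbol G|.
Proof. by rewrite leq_add2l max_card. Qed.

(** The offsets of [a] and [b] already match the largest possible weight; strictness comes from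
    [height a] being positive, since [connect] is reflexive. *)
Lemma weight_pair (a b c : symbol G) : weight c < weight a + weight b.
Proof.
apply: leq_ltn_trans (weight_max c) _; rewrite /weight addnACA.
rewrite -[X in X < _]addn0 ltn_add2l addn_gt0; apply/orP; left.
by apply/card_gt0P; exists a; apply: connect0.
Qed.

Variable n : nat.

Definition item_weight (x : item G n) : nat := weight x.1.1.

(** This invariant keeps the two items of a type 2 head distinct: [A(i,j) = B(j,k)] would force
    [i = j], and the head set would collapse to a singleton carrying only one weight. *)
Definition proper_items (S : {set item G n}) : Prop :=
  forall x, x \in S -> x.1.2 < x.2.

Lemma proper_items_instance (r : rule G) (H : {set item G n}) (b : item G n) :
  instance r H b -> proper_items H -> b.1.2 < b.2.
Proof.
rewrite /instance; case: (Defs.head r) => [A | A B].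
  case/existsP=> i /existsP[j /andP[/eqP-> /eqP->]] pH /=.
  exact: (pH (A, i, j) (set11 _)).
case/existsP=> i /existsP[j /existsP[k /andP[/eqP-> /eqP->]]] pH /=.
exact: ltn_trans (pH (A, i, j) (set21 _ _)) (pH (B, j, k) (set22 _ _)).
Qed.

Lemma item_weight_instance (r : rule G) (H : {set item G n}) (b : item G n) :
  loop_free G -> instance r H b -> proper_items H ->
  item_weight b < \sum_(x in H) item_weight x.
Proof.
move=> lf; rewrite /instance; case Er: (Defs.head r) => [A | A B].
  case/existsP=> i /existsP[j /andP[/eqP-> /eqP->]] _.
  rewrite big_set1 ltn_add2l; apply: height_single_production => //.
  by apply/existsP; exists r; rewrite Er !eqxx.
case/existsP=> i /existsP[j /existsP[k /andP[/eqP-> /eqP->]]] pH.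
have ij := pH (A, i, j) (set21 _ _).
rewrite big_setU1 /= ?big_set1; first exact: weight_pair.
by rewrite inE !xpair_eqE; case: (i =P j) ij => [-> | _ _]; rewrite /= ?ltnn ?andbF.
Qed.

Definition max_total_weight : nat :=
  #|item G n| * (#|symbol G| + #|symbol G|).

(** The lexicographic order packed into one number: the factor exceeds every total weight, so one
    more recorded propagation outweighs any gain in the second summand. *)
Definition measure (c : config G n) : nat :=
  #|~: c.2| * max_total_weight.+1 + \sum_(x in c.1) item_weight x.

Lemma total_weight_max (S : {set item G n}) :
  \sum_(x in S) item_weight x <= max_total_weight.
Proof.
rewrite /max_total_weight.
apply: (@leq_trans (\sum_(x in S) (#|symbol G| + #|symbol G|))).
  by apply: leq_sum => x _; apply: weight_max.
by rewrite sum_nat_const leq_mul2r max_card orbT.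
Qed.

Lemma step_proper_items (c c' : config G n) :
  step c c' -> proper_items c.1 -> proper_items c'.1.
Proof.
case/existsP=> r /existsP[H /existsP[b /and3P[inst HS stp]]] pc.
have pb : b.1.2 < b.2.
  by apply: proper_items_instance inst _ => x /(subsetP HS); apply: pc.
case: (kind r) stp => [/andP[_ /eqP->] | /eqP->] x /=.
  by case/setU1P=> [-> // | /pc].
by case/setU1P=> [-> // | /setDP[/pc]].
Qed.

Lemma step_measure (c c' : config G n) :
  loop_free G -> proper_items c.1 -> step c c' -> measure c' < measure c.
Proof.
move=> lf pc /existsP[r /existsP[H /existsP[b /and3P[inst HS]]]].
rewrite /measure; case: (kind r) => [/andP[rH /eqP->] | /eqP->] /=.
  have -> : #|~: c.2| = #|~: ((r, H) |: c.2)|.+1.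
    by rewrite (cardsD1 (r, H) (~: c.2)) inE rH add1n setCU setDE setIC.
  rewrite mulSn [_.+1 + _]addnC -addnA ltn_add2l ltn_addr //.
  by rewrite ltnS total_weight_max.
rewrite ltn_add2l; apply: ltn_sum_replace => //.
by apply: item_weight_instance inst _ => // x /(subsetP HS); apply: pc.
Qed.

Lemma initial_proper_items (w : n.-tuple (terminal G)) :
  proper_items (initial w).1.
Proof.
by move=> _ /imsetP[m _ ->] /=; rewrite !inordK // ltnS // ltnW.
Qed.

Lemma loop_free_terminates (w : n.-tuple (terminal G)) :
  loop_free G -> terminates w.
Proof.
move=> lf f f0 fS.
(* Induction on a strict bound [m] for the measure, with the time [t] left general. *)
suff reach m t : measure (f t) < m -> proper_items (f t).1 ->
    exists t, final (f t).
  by apply: (reach _ 0 (ltnSn _)); rewrite f0; apply: initial_proper_items.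
elim: m t => // m IHm t lt_m pt.
case: (boolP (final (f t))) => [| /fS stp]; first by exists t.
apply: (IHm t.+1); last exact: step_proper_items stp pt.
exact: leq_trans (step_measure lf pt stp) _.
Qed.

(** Every head prefix has a code, possibly several; an upper bound on their number asks for no
    more. *)
Definition prefix_at (p : rule G * (boundary n * boundary n * boundary n) * bool) :
    rule G * {set item G n} :=
  let: (r, (i, j, k), whole) := p in
  (r, match Defs.head r with
      | One A => [set (A, i, j)]
      | Two A B => if whole then [set (A, i, j); (B, j, k)] else [set (A, i, j)]
      end).

Lemma card_prefix_firings (cs : seq (config G n)) :
  #|prefix_firings cs| <= #|rule G| * n.+1 ^ 3 * 2.
Proof.
have sub : prefix_firings cs \subset prefix_at @: setT.
  apply/subsetP=> -[r P]; rewrite inE => /andP[/= + _].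
  rewrite /head_prefix; case Er: (Defs.head r) => [A | A B].
    case/existsP=> i /existsP[j /eqP->].
    (* The second [j] is only a filler for the third boundary. *)
    by apply/imsetP; exists (r, (i, j, j), true); rewrite ?inE //= Er.
  case/orP=> /existsP[i /existsP[j]].
    move=> /eqP->.
    by apply/imsetP; exists (r, (i, j, j), false); rewrite ?inE //= Er.
  case/existsP=> k /eqP->.
  by apply/imsetP; exists (r, (i, j, k), true); rewrite ?inE //= Er.
apply: leq_trans (subset_leq_card sub) _.
apply: leq_trans (leq_imset_card _ _) _.
by rewrite cardsT !card_prod card_bool !card_ord !expnS expn0 muln1 !mulnA.
Qed.

End Weight.

Theorem mainTheorem2 (G : chr_grammar)
    (time : forall n : nat, n.-tuple (terminal G) -> seq (config G n) -> nat)
    (G_loop_free : loop_free G)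
    (time_bound : meta_complexity time) :
  (forall (n : nat) (w : n.-tuple (terminal G)), terminates w) /\
  exists C : nat, forall (n : nat) (w : n.-tuple (terminal G))
                         (cs : seq (config G n)),
    0 < n -> complete_derivation w cs -> time n w cs <= C * n ^ 3.
Proof.
split=> [n w |]; first exact: loop_free_terminates.
(* The summand 1 pays for [n <= n ^ 3]; the factor [2 ^ 3] comes from [n.+1 <= 2 * n], valid as
   [0 < n]; the last 2 counts the prefix lengths. *)
case: time_bound => c tb; exists (c * (1 + #|rule G| * 2 ^ 3 * 2)) => n w cs n_gt0 dcs.
apply: leq_trans (tb n w cs n_gt0 dcs) _.
rewrite -mulnA leq_mul2l mulnDl mul1n; apply/orP; right.
apply: leq_add; first by rewrite -[X in X <= _]expn1 leq_pexp2l.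
apply: leq_trans (card_prefix_firings _) _.
have cube : n.+1 ^ 3 <= 2 ^ 3 * n ^ 3.
  by rewrite -expnMn leq_exp2r // mul2n -addnn -addn1 leq_add2l.
by rewrite [leqRHS]mulnAC leq_mul2r -[leqRHS]mulnA leq_mul2l cube orbT.
Qed.
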